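(* Let $X=(\Omega,\mathcal F,P)$ be an arbitrary probability space, let $E$ be a finite set, and let $A\in\mathcal F^E$. Then there exists a measurable event $B$ in the Lebesgue product space $\mathcal L^E$ such that $\lambda^E(B)=\mathbb P(A)$ and $I_B(e)=I_A(e)$ for every $e\in E$.
   Context: For a probability space $X=(\Omega,\mathcal F,P)$ and a finite set $E$, $X^E=(\Omega^E,\mathcal F^E,\mathbb P=P^E)$ denotes the product probability space of $|E|$ copies of $X$ indexed by $E$ ($\mathcal F^E$ is the product $\sigma$-field; no completeness or separability is assumed). For $e\in E$ and $\psi\in\Omega^{E\setminus\{e\}}$, the fibre is $F_\psi=\{\omega\in\Omega^E:\omega(f)=\psi(f)\text{ for } f\neq e\}\simeq\{\psi\}\times\Omega$. Via the identification $F_\psi\simeq\Omega$ (by $\omega\mapsto\omega(e)$), for $A\in\mathcal F^E$ write $P(A\cap F_\psi)$ for the $P$-measure of the section $\{\omega(e):\omega\in A\cap F_\psi\}\subseteq\Omega$. The influence of $e\in E$ on $A\in\mathcal F^E$ is $$I_A(e)=P^{E\setminus\{e\}}\bigl(\{\psi\in\Omega^{E\setminus\{e\}}:0<P(A\cap F_\psi)<1\}\bigr).$$ The notation $I_A(e)$ does not display the underlying space: influences of $A\in\mathcal F^E$ are computed in $X^E$, and influences of an event $B$ of $\mathcal L^E$ are computed by the same definition with $X$ replaced by $\mathcal L$. $\mathcal L=([0,1],\mathcal B[0,1],\lambda)$ is the Lebesgue probability space: the unit interval with its Borel $\sigma$-field and Lebesgue measure $\lambda$. $\mathcal L^E$ is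 its $E$-fold product, with measure $\lambda^E$. *)

(* Defs.v *)
From HB Require Import structures.
From mathcomp Require Import all_boot all_order all_algebra.
From mathcomp Require Import all_classical all_reals all_analysis.

Set Implicit Arguments.
Unset Strict Implicit.
Unset Printing Implicit Defensive.
Import Order.TTheory GRing.Theory Num.Theory.
Local Open Scope classical_set_scope.
Local Open Scope ring_scope.

(* An alias of [E -> T], so that the measurable structure below is not attached
   to all function types. *)
Definition power (E : finType) (T : Type) : Type := E -> T.

HB.instance Definition _ (E : finType) (T : pointedType) :=
  Pointed.on (power E T).

Definition power_display : measure_display -> measure_display.
Proof. exact. Qed.

Section power_measurable.
Context (E : finType) d (T : measurableType d).

(* The product sigma-field is the smallest one making every coordinate
   measurable. *)
Definition power_cylinder : set (set (power E T)) :=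
  \bigcup_(e in [set: E])
    preimage_set_system setT (fun w : power E T => w e) measurable.

HB.instance Definition _ := @isMeasurable.Build (power_display d)
  (power E T) <<s power_cylinder >>
  (@sigma_algebra0 _ setT power_cylinder)
  (@sigma_algebraC _ power_cylinder)
  (@sigma_algebra_bigcup _ setT power_cylinder).

Lemma measurable_power_proj (e : E) :
  measurable_fun [set: power E T] (fun w : power E T => w e).
Proof.
move=> _ Y mY; apply: sub_sigma_algebra; exists e => //.
by exists Y.
Qed.

Lemma measurable_fun_powerP d' (U : measurableType d') (f : U -> power E T) :
  (forall e, measurable_fun setT (fun u => f u e)) -> measurable_fun setT f.
Proof.
move=> mf; apply: (@measurability _ _ _ _ _ _ power_cylinder) => //.
move=> _ [_ [e _ [Y mY <-]] <-]; rewrite setTI.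
exact: (mf e measurableT Y mY).
Qed.

Lemma measurable_power_box (A : E -> set T) :
  (forall e, measurable (A e)) ->
  measurable [set w : power E T | forall e, A e (w e)].
Proof.
move=> mA.
rewrite (_ : [set _ | _] =
    \bigcap_(e in [set: E]) ((fun w : power E T => w e) @^-1` A e)); last first.
  by apply/seteqP; split=> [w Aw e _|w Aw e]; exact: Aw.
apply: fin_bigcap_measurable; first exact: finite_finset.
move=> e _; rewrite -[X in measurable X]setTI.
exact: measurable_power_proj.
Qed.

End power_measurable.

Section tuple_cons.
Context d (T : measurableType d) (n : nat).

Definition tuple_cons (x : T * n.-tuple T) : n.+1.-tuple T :=
  [tuple of x.1 :: x.2].

Let measurable_tuple_cons : measurable_fun setT tuple_cons.
Proof. by apply: measurable_cons. Qed.

HB.instance Definition _ :=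
  isMeasurableFun.Build _ _ _ _ tuple_cons measurable_tuple_cons.

End tuple_cons.

Section power_of_tuple.
Context (E : finType) d (T : measurableType d).

Definition power_of_tuple (t : #|E|.-tuple T) : power E T :=
  fun e => tnth t (enum_rank e).

Let measurable_power_of_tuple : measurable_fun setT power_of_tuple.
Proof. by apply: measurable_fun_powerP => e; exact: measurable_tnth. Qed.

HB.instance Definition _ :=
  isMeasurableFun.Build _ _ _ _ power_of_tuple measurable_power_of_tuple.

End power_of_tuple.

Section power_prob.
Context d (T : measurableType d) (R : realType) (P : probability T R).

Fixpoint tuple_prob (n : nat) : probability (n.-tuple T) R :=
  match n with
  | 0 => \d_ [tuple]
  | m.+1 => distribution (P \x tuple_prob m)%E (@tuple_cons _ T m)
  end.

(* The product measure [P^E]; [power_prob_box] and [power_prob_unique] show that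
   it does not depend on the enumeration of [E] used here. *)
Definition power_prob (E : finType) : probability (power E T) R :=
  distribution (tuple_prob #|E|) (@power_of_tuple E _ T).

Lemma tuple_prob_box n (A : 'I_n -> set T) : (forall i, measurable (A i)) ->
  tuple_prob n [set t | forall i, A i (tnth t i)] = (\prod_(i < n) P (A i))%E.
Proof.
elim: n A => [|n IH] A mA.
  by rewrite big_ord0 /= diracE mem_set// => -[].
rewrite big_ord_recl /= -(IH (fun i => A (lift ord0 i)))//.
rewrite /distribution /pushforward /=.
rewrite -product_measure1E//; last first.
  rewrite (_ : [set _ | _] = \bigcap_(i in [set: 'I_n])
     ((fun t : n.-tuple T => tnth t i) @^-1` A (lift ord0 i))); last first.
    by apply/seteqP; split=> [w Aw e _|w Aw e]; exact: Aw.
  apply: fin_bigcap_measurable; first exact: finite_finset.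
  move=> i _; rewrite -[X in measurable X]setTI.
  exact: measurable_tnth.
congr (_ _); apply/seteqP; split=> [[x t]/= At|[x t]/= [Ax At] i].
  split; first exact: (At ord0).
  by move=> i; move: (At (lift ord0 i)); rewrite /tuple_cons tnthS.
have [j ->|->//] := unliftP ord0 i.
by rewrite /tuple_cons tnthS.
Qed.

Lemma power_prob_box (E : finType) (A : E -> set T) :
  (forall e, measurable (A e)) ->
  power_prob E [set w | forall e, A e (w e)] = (\prod_(e : E) P (A e))%E.
Proof.
move=> mA; rewrite /power_prob /distribution /pushforward /=.
rewrite (reindex _ (onW_bij _ (@enum_val_bij E))) /=.
rewrite -(tuple_prob_box (A := fun i => A (enum_val i)))//.
apply: (congr1 (tuple_prob #|E|)).
apply/seteqP; split=> [t At i|t At e].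
  by have := At (enum_val i); rewrite /= /power_of_tuple enum_valK.
by have := At (enum_rank e); rewrite /= enum_rankK.
Qed.

Lemma power_prob_unique (E : finType) (m : probability (power E T) R) :
  (forall A : E -> set T, (forall e, measurable (A e)) ->
    m [set w | forall e, A e (w e)] = (\prod_(e : E) P (A e))%E) ->
  forall X, measurable X -> m X = power_prob E X.
Proof.
move=> mE X mX.
pose G : set (set (power E T)) :=
  [set [set w | forall e, A e (w e)] | A in [set A | forall e, measurable (A e)]].
apply: (measure_unique G (fun=> setT)) => //.
- apply/seteqP; split; apply: smallest_sub.
  + exact: smallest_sigma_algebra.
  + move=> _ [e _ [Y mY <-]]; apply: sub_sigma_algebra.
    exists (fun f => if f == e then Y else setT).
      by move=> f /=; case: ifP.
    apply/seteqP; split=> [w Aw|w [_ Yw] f /=].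
      by split=> //; have := Aw e; rewrite eqxx.
    by case: eqP => // ->.
  + exact: sigma_algebra_measurable.
  + by move=> _ [A mA <-]; exact: measurable_power_box.
- move=> _ _ [A mA <-] [B mB <-]; exists (fun e => A e `&` B e).
    by move=> e; apply: measurableI; [exact: mA|exact: mB].
  apply/seteqP; split=> [w ABw|w [Aw Bw] e].
    by split=> e; have [] := ABw e.
  by split; [exact: Aw|exact: Bw].
- by move=> _; exists (fun=> setT) => //; apply/seteqP; split.
- by rewrite bigcup_const.
- by move=> _ [A mA <-]; exact: etrans (mE A mA) (esym (power_prob_box mA)).
- by move=> _; rewrite [X in (X < _)%E](probability_setT m) ltry.
Qed.

End power_prob.

Section influence.
Context d (T : measurableType d) (R : realType) (P : probability T R).
Context (E : finType).

Definition fibre (e : E) (psi : power {f : E | f != e} T) : set (power E T) :=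
  [set w | forall f : {f : E | f != e}, w (val f) = psi f].

Definition fibre_section (A : set (power E T)) (e : E)
    (psi : power {f : E | f != e} T) : set T :=
  [set w e | w in A `&` fibre psi].

(* The set of [psi] below is measurable when [A] is, by Fubini; the measure being
   total, the definition need not say so. *)
Definition influence (A : set (power E T)) (e : E) : \bar R :=
  power_prob P {f : E | f != e}
    [set psi | (0 < P (fibre_section A psi) < 1)%E].

End influence.

Section unit_interval.
Context (R : realType).

Definition unit_itv : Type := {x : R | x \in `[0, 1]}.

HB.instance Definition _ := Choice.on unit_itv.

Let zero_in : (0 : R) \in `[0, 1]. Proof. by rewrite in_itv /= lexx ler01. Qed.

HB.instance Definition _ := isPointed.Build unit_itv (exist _ 0 zero_in).

Definition unit_itv_val (x : unit_itv) : measurableTypeR R := sval x.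

(* The Borel sigma-field of [0, 1], as the trace of that of the line. *)
Definition lebesgue_itv : Type := g_sigma_algebra_preimageType unit_itv_val.

HB.instance Definition _ := Measurable.on lebesgue_itv.

Lemma unit_itv_val_inj : injective unit_itv_val.
Proof. exact: val_inj. Qed.

Lemma range_unit_itv_val : range unit_itv_val = `[0, 1]%classic.
Proof.
apply/seteqP; split=> [_ [[x xP] _ <-]//|x xP].
by exists (exist _ x xP).
Qed.

Lemma measurable_unit_itv_image (A : set lebesgue_itv) : measurable A ->
  measurable (unit_itv_val @` A).
Proof.
move=> [B mB <-]; rewrite setTI.
rewrite (_ : _ @` _ = B `&` `[0, 1]%classic); last first.
  rewrite -range_unit_itv_val; apply/seteqP; split=> [_ [x Bx <-]|x [Bx [y _ yx]]].
    by split=> //; exists x.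
  by exists y; rewrite /= ?yx.
by apply: measurableI => //; exact: measurable_itv.
Qed.

(* [lebesgue_measure] is here the measure on the Borel sets of the line. *)
Definition lebesgue_itv_prob (A : set lebesgue_itv) : \bar R :=
  lebesgue_measure (unit_itv_val @` A).

Let lebesgue_itv0 : lebesgue_itv_prob set0 = 0%E.
Proof. by rewrite /lebesgue_itv_prob image_set0 measure0. Qed.

Let lebesgue_itv_ge0 A : (0 <= lebesgue_itv_prob A)%E.
Proof. exact: measure_ge0. Qed.

Let lebesgue_itv_sigma_additive : semi_sigma_additive lebesgue_itv_prob.
Proof.
move=> F mF tF _; rewrite /lebesgue_itv_prob image_bigcup.
apply: measure_sigma_additive.
  by move=> n; exact: measurable_unit_itv_image.
apply/trivIsetP => i j _ _ ij.
move/trivIsetP : tF => /(_ i j Logic.I Logic.I ij) Fij.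
apply/seteqP; split=> // _ [[x Fx <-] [y + /unit_itv_val_inj yx]].
rewrite yx => Fy; have : (F i `&` F j) x by [].
by rewrite Fij.
Qed.

HB.instance Definition _ := isMeasure.Build _ _ _ lebesgue_itv_prob
  lebesgue_itv0 lebesgue_itv_ge0 lebesgue_itv_sigma_additive.

Let lebesgue_itvT : lebesgue_itv_prob setT = 1%E.
Proof.
rewrite /lebesgue_itv_prob range_unit_itv_val lebesgue_measure_itv/=.
by rewrite lte_fin ltr01 oppr0 adde0.
Qed.

HB.instance Definition _ := Measure_isProbability.Build _ _ _
  lebesgue_itv_prob lebesgue_itvT.

End unit_interval.

(* Main.v *)
Require Import Defs.
From HB Require Import structures.
From mathcomp Require Import all_boot all_order all_algebra.
From mathcomp Require Import all_classical all_reals all_analysis.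
From mathcomp Require Import measurable_realfun ring lra.

(* A measurable event of a finite power depends, through each coordinate, on
   countably many measurable sets C_n only.  Coding the bits 1_{C_n}(x) as a
   ternary expansion gives a measurable phi : T -> R that determines them, so A
   is the preimage under phi^E of a Borel set A'.  Let q be the quantile function
   of the law of phi; it carries the Lebesgue measure to that law, and B is the
   preimage of A' under q^E.  Preimages under f^E for a measure-preserving f keep
   both the probability and the influences: sections are preimages under f of
   sections, and being pivotal is an event (Fubini) of the remaining
   coordinates. *)

Set Implicit Arguments.
Unset Strict Implicit.
Unset Printing Implicit Defensive.
Import Order.TTheory GRing.Theory Num.Theory.
Import numFieldNormedType.Exports.
Local Open Scope classical_set_scope.
Local Open Scope ring_scope.

(** * Powers of a measure-preserving map *)

Section measure_preserving.
Context d d' (T : measurableType d) (T' : measurableType d') (R : realType).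
Context (P : probability T R) (Q : probability T' R) (f : T -> T').
Context (E : finType).
Hypothesis mf : measurable_fun setT f.
Hypothesis PfQ : forall X, measurable X -> P (f @^-1` X) = Q X.

Definition power_map (w : power E T) : power E T' := f \o w.

Lemma measurable_power_map : measurable_fun setT power_map.
Proof.
apply: measurable_fun_powerP => e.
exact: (measurableT_comp mf (measurable_power_proj e)).
Qed.

#[local] HB.instance Definition _ :=
  isMeasurableFun.Build _ _ _ _ power_map measurable_power_map.

(** The image of $P^E$ under $f^E$ gives boxes the same mass as $Q^E$, and boxes determine a
    probability on the power. *)
Lemma power_prob_preimage (X : set (power E T')) :
  measurable X -> power_prob P E (power_map @^-1` X) = power_prob Q E X.
Proof.
move=> mX.
apply: (@power_prob_unique _ _ _ Q E
  (distribution (power_prob P E) power_map) _ X mX) => A mA.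
transitivity (\prod_(e : E) P (f @^-1` A e))%E; last first.
  by apply: eq_bigr => e _; exact: PfQ.
apply: (power_prob_box P (A := fun e => f @^-1` A e)) => e.
by rewrite -[X in measurable X]setTI; exact: mf.
Qed.

End measure_preserving.

(** * Fibres, sections and pivotality *)

Section fibres.
Context (E : finType) (e : E).

(** [insub f] fails exactly at [f = e], where the first component is used. *)
Definition fibre_point T (x : T * power {f : E | f != e} T) : power E T :=
  fun f => if insub f is Some g then x.2 g else x.1.

Lemma fibre_point_at T (x : T * power {f : E | f != e} T) :
  fibre_point x e = x.1.
Proof. by rewrite /fibre_point insubF// eqxx. Qed.

Lemma fibre_point_off T (x : T * power {f : E | f != e} T)
  (g : {f : E | f != e}) : fibre_point x (val g) = x.2 g.
Proof. by rewrite /fibre_point valK. Qed.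

Lemma fibre_pointK T (w : power E T) :
  fibre_point (w e, fun g : {f : E | f != e} => w (val g)) = w.
Proof.
apply/funext => f; rewrite /fibre_point; case: insubP => [g _ <-//|].
by rewrite negbK => /eqP ->.
Qed.

Context d (T : measurableType d).

Lemma fibre_sectionE (A : set (power E T))
    (psi : power {f : E | f != e} T) :
  fibre_section A psi = [set t | A (fibre_point (t, psi))].
Proof.
apply/seteqP; split=> [_ [w [Aw wpsi] <-]|t At] /=.
  by rewrite (_ : psi = fun g => w (val g)) ?fibre_pointK//; exact/funext.
exists (fibre_point (t, psi)); last exact: fibre_point_at.
by split=> // g; exact: fibre_point_off.
Qed.

Lemma measurable_fibre_point : measurable_fun setT (@fibre_point T).
Proof.
apply: measurable_fun_powerP => f; rewrite /fibre_point.
case: insubP => [g _ _|_]; last exact: measurable_fst.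
exact: (measurableT_comp (measurable_power_proj g) measurable_snd).
Qed.

Lemma fibre_section_ysection (A : set (power E T))
    (psi : power {f : E | f != e} T) :
  fibre_section A psi = ysection (@fibre_point T @^-1` A) psi.
Proof.
by rewrite fibre_sectionE; apply/seteqP; split=> t;
  rewrite /ysection /= in_setE.
Qed.

Lemma measurable_preimage_fibre_point (A : set (power E T)) :
  measurable A -> measurable (@fibre_point T @^-1` A).
Proof.
by move=> mA; rewrite -[X in measurable X]setTI; exact: measurable_fibre_point.
Qed.

Lemma measurable_fibre_section (A : set (power E T))
    (psi : power {f : E | f != e} T) :
  measurable A -> measurable (fibre_section A psi).
Proof.
move=> mA; rewrite fibre_section_ysection; apply: measurable_ysection.
exact: measurable_preimage_fibre_point.
Qed.

(** The sections are the [ysection]s of one measurable subset of a product, so their measure depends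
    measurably on [psi]. *)
Lemma measurable_pivotal (R : realType) (P : probability T R)
    (A : set (power E T)) : measurable A ->
  measurable [set psi : power {f : E | f != e} T |
    (0 < P (fibre_section A psi) < 1)%E].
Proof.
move=> mA.
under eq_set do rewrite fibre_section_ysection.
have := measurable_fun_ysection P (measurable_preimage_fibre_point mA).
set g := (g in measurable_fun _ g) => mg.
rewrite (_ : [set _ | _] = g @^-1` [set` `]0%E, 1%E[]).
  by rewrite -[X in measurable X]setTI; apply: mg => //; exact: emeasurable_itv.
by apply/seteqP; split=> psi; rewrite /= in_itv.
Qed.

End fibres.

(** * Invariance of the influence *)

Section influence_preimage.
Context d d' (T : measurableType d) (T' : measurableType d') (R : realType).
Context (P : probability T R) (Q : probability T' R) (f : T -> T').
Hypothesis mf : measurable_fun setT f.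
Hypothesis PfQ : forall X, measurable X -> P (f @^-1` X) = Q X.

Lemma influence_preimage (E : finType) (A : set (power E T')) (e : E) :
  measurable A ->
  influence P (power_map f (E:=E) @^-1` A) e = influence Q A e.
Proof.
move=> mA; rewrite /influence.
(* The pivotal event for [Q] is measurable, so its probability is that of its preimage under the
   power of [f] over the remaining coordinates. *)
rewrite -(power_prob_preimage mf PfQ (@measurable_pivotal _ e _ _ _ Q _ mA)).
apply: (congr1 (power_prob P {g : E | g != e})); apply/funext => psi /=.
rewrite -PfQ; last exact: measurable_fibre_section.
rewrite (_ : fibre_section (power_map f (E:=E) @^-1` A) psi =
  f @^-1` (fibre_section A (power_map f psi)))//.
rewrite !fibre_sectionE; apply/funext => t /=; congr (A _).
apply/funext => g; rewrite /power_map /= /fibre_point.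
by case: insubP.
Qed.

End influence_preimage.

(** * Dependence on countably many sets *)

Section countably_generated.
Context d (T : measurableType d) (E : finType).

(** One sequence serves all coordinates, so that a single code on [T] can be applied at every
    [e]. *)
Definition seq_cylinder (C : nat -> set T) : set (set (power E T)) :=
  [set X | exists n e, X = [set w | C n (w e)]].

Lemma measurable_seq_cylinder (A : set (power E T)) : measurable A ->
  exists2 C : nat -> set T, (forall n, measurable (C n)) &
    <<s seq_cylinder C >> A.
Proof.
pose S : set (set (power E T)) := [set A | exists2 C : nat -> set T,
  (forall n, measurable (C n)) & <<s seq_cylinder C >> A].
move: A; suff : measurable `<=` S by [].
apply: smallest_sub; last first.
  move=> _ [e _ [Y mY <-]]; exists (fun=> Y) => //.
  by apply: sub_sigma_algebra; exists 0%N, e; rewrite setTI.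
split=> [|A [C mC CA]|F SF].
- by exists (fun=> set0) => //; exact: sigma_algebra0.
- by exists C => //; rewrite setTD; exact: sigma_algebraC.
- have /choice[C HC] : forall n, exists C : nat -> set T,
      (forall k, measurable (C k)) /\ <<s seq_cylinder C >> (F n).
    by move=> n; have [C mC CF] := SF n; exists C.
  (* Merges the sequences [C i] along a coding of pairs; integers coding no pair get [set0]. *)
  pose D n := if unpickle n is Some p then C p.1 p.2 else set0.
  exists D.
    by move=> n; rewrite /D; case: unpickle => // p; exact: (HC p.1).1.
  have [_ _] := smallest_sigma_algebra setT (seq_cylinder D).
  apply => i; apply: sub_sigma_algebra2 (HC i).2.
  move=> _ [n [e ->]].
  by exists (pickle (i, n)), e; rewrite /D pickleK.
Qed.

End countably_generated.

(** * Ternary coding of bit sequences *)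

Section ternary_code.
Context (R : realType).

(** The partial sum $\sum_{k<n} 2b_k3^{-k-1}$ in Horner form, which exposes the first digit. *)
Fixpoint ternary_trunc (n : nat) (b : nat -> bool) : R :=
  if n is m.+1 then ((b 0%N)%:R *+ 2 + ternary_trunc m (b \o S)) / 3 else 0.

Lemma ternary_trunc_itv n b : 0 <= ternary_trunc n b <= 1.
Proof.
elim: n b => [|n IH] b /=; first by rewrite lexx ler01.
by have := IH (b \o S); case: (b 0%N) => /=; lra.
Qed.

Lemma ternary_trunc_nondecreasing b :
  nondecreasing_seq (fun n => ternary_trunc n b).
Proof.
apply/nondecreasing_seqP => n; elim: n b => [|n IH] b.
  by have /andP[] := ternary_trunc_itv 1 b.
by rewrite /= ler_pM2r ?invr_gt0 ?ltr0n// lerD2l; exact: IH.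
Qed.

Definition ternary (b : nat -> bool) : R :=
  limn (fun n => ternary_trunc n b).

Lemma cvg_ternary b : ternary_trunc n b @[n --> \oo] --> ternary b.
Proof.
apply: nondecreasing_is_cvgn; first exact: ternary_trunc_nondecreasing.
by exists 1 => _ [n _ <-]; have /andP[] := ternary_trunc_itv n b.
Qed.

Lemma ternary_itv b : 0 <= ternary b <= 1.
Proof.
apply/andP; split.
  apply: limr_ge; first exact: cvg_ternary.
  by apply: nearW => n; have /andP[] := ternary_trunc_itv n b.
apply: limr_le; first exact: cvg_ternary.
by apply: nearW => n; have /andP[] := ternary_trunc_itv n b.
Qed.

Lemma ternary_rec b : ternary b = ((b 0%N)%:R *+ 2 + ternary (b \o S)) / 3.
Proof.
apply/cvg_lim => //; rewrite -cvg_shiftS /=.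
apply: cvgMr_tmp; apply: cvgD; [exact: cvg_cst|exact: cvg_ternary].
Qed.

(* Digits are 0 or 2, so the code lies in [0, 1/3] or in [2/3, 1]: comparison
   with 1/2 reads the first digit. *)
Definition ternary_shift (y : R) : R := 3 * y - (2^-1 < y)%R%:R *+ 2.

Lemma ternary_bit0 b : (2^-1 < ternary b) = b 0%N.
Proof.
rewrite ternary_rec; have := ternary_itv (b \o S).
case: (b 0%N) => /= h; last by apply/negbTE; rewrite -leNgt; lra.
by apply/idP; lra.
Qed.

Lemma ternary_shiftE b : ternary_shift (ternary b) = ternary (b \o S).
Proof. by rewrite /ternary_shift ternary_bit0 ternary_rec; field. Qed.

Lemma ternary_bit n b : (2^-1 < iter n ternary_shift (ternary b)) = b n.
Proof.
elim: n b => [|n IH] b; first exact: ternary_bit0.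
by rewrite iterSr ternary_shiftE IH.
Qed.

Lemma measurable_ternary_shift : measurable_fun setT ternary_shift.
Proof.
apply: measurable_funB; first exact: measurable_funM.
rewrite (_ : (fun _ => _) = fun y => (\1_(`]2^-1, +oo[ : set R) y : R) *+ 2).
  by apply: (measurableT_comp (natmul_measurable 2)).
by apply/funext => y; rewrite indicE mem_setE in_itv/= andbT.
Qed.

Lemma measurable_ternary_bit n :
  measurable [set y | 2^-1 < iter n ternary_shift y].
Proof.
have mi : measurable_fun setT (iter n ternary_shift).
  elim: n => [|n IH]; first exact: measurable_id.
  exact: (measurableT_comp measurable_ternary_shift IH).
rewrite (_ : [set _ | _] = iter n ternary_shift @^-1` `]2^-1, +oo[).
  by rewrite -[X in measurable X]setTI; exact: mi.
by apply/seteqP; split=> y; rewrite /= in_itv/= andbT.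
Qed.

Context d (T : measurableType d) (C : nat -> set T).
Hypothesis mC : forall n, measurable (C n).

Lemma measurable_ternary :
  measurable_fun setT (fun x => ternary (fun n => x \in C n)).
Proof.
apply: (measurable_fun_cvg
  (h := fun m x => ternary_trunc m (fun n => x \in C n))); last first.
  by move=> x _; exact: cvg_ternary.
(* [C] is generalized because the recursion shifts the digit sequence. *)
move=> m; elim: m C mC => [|m IH] D mD /=; first exact: measurable_cst.
apply: measurable_funM; last exact: measurable_cst.
apply: measurable_funD; last exact: (IH _ (fun n => mD n.+1)).
exact: (measurableT_comp (natmul_measurable 2) (measurable_indic (mD 0%N))).
Qed.

End ternary_code.

(** * The quantile function of a law on the line *)

Section quantile.
Context (R : realType) (mu : probability (measurableTypeR R) R).

Let F x : R := fine (mu `]-oo, x]%classic).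

Let FE x : (F x)%:E = mu `]-oo, x]%classic.
Proof. by rewrite fineK ?fin_num_measure. Qed.

Let F_itv x : 0 <= F x <= 1.
Proof. by rewrite -!lee_fin FE measure_ge0 probability_le1. Qed.

(** [cdf] takes a random variable; the identity is one whose law is [mu]. *)
Let idR : measurableTypeR R -> R := idfun.

#[local] HB.instance Definition _ :=
  @isMeasurableFun.Build _ _ _ _ idR (@measurable_id _ _ setT).

Let FcdfE : F = fun x => fine (cdf (idR : {RV mu >-> R}) x).
Proof. by []. Qed.

Let F_nd x y : x <= y -> F x <= F y.
Proof.
by move=> xy; rewrite fine_le ?fin_num_measure//;
  exact: (@cdf_nondecreasing _ _ _ mu idR).
Qed.

Let F_rc x : F y @[y --> x^'+] --> F x.
Proof.
rewrite FcdfE; apply: fine_cvg.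
by rewrite fineK ?fin_num_measure//; exact: cdf_right_continuous.
Qed.

Let F_Ny : F x @[x --> -oo] --> (0 : R).
Proof. by rewrite FcdfE; exact/fine_cvg/cvg_cdfNy0. Qed.

Let F_y : F x @[x --> +oo] --> (1 : R).
Proof. by rewrite FcdfE; exact/fine_cvg/cvg_cdfy1. Qed.

(* The endpoints are excluded because the infimum there may be over an empty or
   unbounded set, where [inf] is a junk value. *)
Definition quantile (u : R) : R :=
  if 0 < u < 1 then inf [set x | u <= fine (mu `]-oo, x]%classic)] else 0.

(** The limits 0 and 1 of [F] make [S] bounded below and nonempty; right continuity puts its infimum
    in [S]. *)
Let quantile_le u x : 0 < u < 1 -> (quantile u <= x) = (u <= F x).
Proof.
move=> u01; rewrite /quantile u01; case/andP: u01 => u0 u1.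
rewrite -/(F _); set S := [set y | _].
have Slb : has_lbound S.
  have /cvgr_lt/(_ u u0)[M [_ MF]] := F_Ny.
  exists (M - 1) => y uFy; rewrite leNgt; apply/negP => yM.
  have := MF y; rewrite /= => /(_ _)/wrap[]; first by lra.
  by rewrite ltNge uFy.
have Sne : S !=set0.
  have /cvgr_gt/(_ u u1)[M [_ MF]] := F_y.
  by exists (M + 1); apply/ltW/MF; rewrite ltrDl.
apply/idP/idP => [Sx|uFx]; last exact: ge_inf.
rewrite leNgt; apply/negP => Fxu.
(* If [F x < u], right continuity keeps [F] below [u] up to [x + e / 2], which then bounds [S] from
   below, against [inf S <= x]. *)
have [e /= e0 xe] := (@cvgr_lt _ _ _ _ _ _ (@F_rc x) u Fxu).
have Fxeu : F (x + e / 2) < u.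
  apply: xe; last by rewrite ltrDl divr_gt0.
  by rewrite /ball/= opprD addrA subrr sub0r normrN gtr0_norm ?divr_gt0//; lra.
have : x + e / 2 <= inf S.
  apply: lb_le_inf => // y uFy; rewrite leNgt; apply/negP => yx.
  have := F_nd (ltW yx).
  by move=> /(le_trans uFy)/(lt_le_trans Fxeu); rewrite ltxx.
by move=> /le_trans/(_ Sx); rewrite gerDl; lra.
Qed.

Lemma measurable_quantile : measurable_fun setT quantile.
Proof.
apply: (measurability (@RGenOInfty.G R)) => [|_ [_ [x ->] <-]].
  exact: RGenOInfty.measurableE.
rewrite setTI -setCitvl -preimage_setC; apply: measurableC.
(* Outside []0, 1[] the quantile is the default 0, which lies in the ray exactly when [0 <= x]. *)
rewrite (_ : quantile @^-1` `]-oo, x]%classic =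
    `]0, 1[%classic `&` `]-oo, F x]%classic `|`
    ~` `]0, 1[%classic `&` [set _ | 0 <= x]).
  apply: measurableU; first exact: measurableI.
  apply: measurableI; first exact: measurableC.
  have [x0|x0] := boolP (0 <= x).
    by rewrite (_ : [set _ | _] = setT)//; apply/seteqP; split.
  by rewrite (_ : [set _ | _] = set0)//; apply/seteqP; split.
apply/seteqP; split=> u /=; rewrite !in_itv /=.
  have [u01|u01] := boolP (0 < u < 1).
    by rewrite quantile_le//; left.
  by rewrite {1}/quantile (negbTE u01); right.
by move=> [[u01]|[/negP/negbTE u01]];
  [rewrite quantile_le|rewrite /quantile u01].
Qed.

(** Up to the endpoints 0 and 1, the set is the interval from 0 to [F x]; it is squeezed between two
    sets of measure [F x]. *)
Let quantile_Iic x :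
  lebesgue_measure (`[0, 1]%classic `&` quantile @^-1` `]-oo, x]%classic) =
  (F x)%:E.
Proof.
have mq : measurable (`[0, 1]%classic `&` quantile @^-1` `]-oo, x]%classic).
  apply: measurableI => //; rewrite -[X in measurable X]setTI.
  exact: measurable_quantile.
have /andP[F0 F1] := F_itv x.
apply/eqP; rewrite eq_le; apply/andP; split.
  (* The null point 1 is added because the default value there may lie in the ray even when
     [F x < 1]. *)
  apply: (@le_trans _ _ (lebesgue_measure
    (`[0, F x]%classic `|` [set (1 : R)]))).
    apply: le_measure; rewrite ?inE//; first exact: measurableU.
    move=> u /= []; rewrite !in_itv /= => /andP[u0 u1] qu.
    have [->|u_neq1] := eqVneq u 1; first by right.
    left; rewrite u0; have [->//|u_neq0] := eqVneq u 0.
    by rewrite -quantile_le// !lt_neqAle eq_sym u_neq0 u0 u_neq1.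
  apply: (le_trans (measureU2 _ _ _)) => //.
  rewrite /= lebesgue_measure_itv lebesgue_measure_set1 /= adde0 lte_fin.
  by case: ifP => _; rewrite ?oppr0 ?adde0 ?lee_fin.
have : (lebesgue_measure (`]0%R, F x[ : set R) <=
    lebesgue_measure (`[0%R, 1%R]%classic `&`
      quantile @^-1` `]-oo, x]%classic))%E.
  apply: le_measure; rewrite ?inE// => u /=; rewrite !in_itv /= => /andP[u0 uF].
  have u1 : u < 1 by exact: lt_le_trans F1.
  by rewrite quantile_le ?u0// !ltW.
rewrite lebesgue_measure_itv /= lte_fin; case: ifPn => [_|].
  by rewrite oppr0 adde0.
by rewrite -leNgt => Fx0 _; apply: le_trans (measure_ge0 _ _); rewrite lee_fin.
Qed.

Definition quantile_itv (u : lebesgue_itv R) : measurableTypeR R :=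
  quantile (unit_itv_val u).

Lemma measurable_quantile_itv : measurable_fun setT quantile_itv.
Proof.
apply: (measurableT_comp measurable_quantile) => _ Y mY.
by exists Y.
Qed.

#[local] HB.instance Definition _ :=
  isMeasurableFun.Build _ _ _ _ quantile_itv measurable_quantile_itv.

(** Both laws agree on the closed left rays, which are stable under intersection, generate the Borel
    sets and exhaust the line. *)
Lemma quantile_itv_preimage X : measurable X ->
  lebesgue_itv_prob (quantile_itv @^-1` X) = mu X.
Proof.
move=> mX.
pose nu := distribution (@lebesgue_itv_prob R) quantile_itv.
pose G : set (set (measurableTypeR R)) :=
  [set A | exists x, A = `]-oo, x]%classic].
apply: (@measure_unique _ _ _ G (fun n => `]-oo, n%:R]%classic)
  _ _ _ _ nu) => //.
- rewrite [LHS](RGenOInfty.measurableE R); apply/seteqP; split;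
    apply: smallest_sub; first exact: smallest_sigma_algebra.
  + move=> _ [x ->]; rewrite -setCitvl; apply: sigma_algebraC.
    by apply: sub_sigma_algebra; exists x.
  + exact: smallest_sigma_algebra.
  + move=> _ [x ->]; rewrite -setCitvr; apply: sigma_algebraC.
    by apply: sub_sigma_algebra; exists x.
- move=> _ _ [x ->] [y ->]; exists (Num.min x y).
  by apply/seteqP; split=> z; rewrite /= !in_itv /= le_min => /andP.
- by move=> n; exists n%:R.
- apply/seteqP; split=> // x _; exists (Num.truncn x).+1 => //=.
  by rewrite in_itv /= ltW// truncnS_gt.
- move=> _ [x ->]; apply: etrans (FE x); rewrite -quantile_Iic.
  rewrite /nu /distribution /pushforward /lebesgue_itv_prob.
  congr (lebesgue_measure _); rewrite -range_unit_itv_val.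
  apply/seteqP; split=> [_ [u qu <-]|_ [[u _ <-] qu]].
    by split=> //; exists u.
  by exists u.
- by move=> n; rewrite (le_lt_trans (probability_le1 _ _)) ?ltry.
Qed.

End quantile.

(** * Factorization through the real line, and conclusion *)

Lemma ternary_factorization (R : realType) (E : finType) d
    (T : measurableType d) (C : nat -> set T) (A : set (power E T)) :
  <<s seq_cylinder C >> A ->
  exists2 A' : set (power E (measurableTypeR R)), measurable A' &
    A = power_map (fun x => ternary R (fun n => x \in C n)) (E:=E) @^-1` A'.
Proof.
set phi := (X in power_map X).
pose S := [set A | exists2 A' : set (power E (measurableTypeR R)),
  measurable A' & A = power_map phi (E:=E) @^-1` A'].
(* [S] is a preimage sigma-field, so only the generating cylinders need a witness. *)
suff : <<s @seq_cylinder _ T E C >> `<=` S by exact.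
apply: smallest_sub => [|_ [n [e ->]]].
  rewrite (_ : S = preimage_set_system setT (power_map phi (E:=E)) measurable).
    by apply: sigma_algebra_preimage; exact: sigma_algebra_measurable.
  apply/seteqP; split=> [_ [A' mA' ->]|_ [A' mA' <-]]; exists A' => //.
    by rewrite setTI.
  by rewrite setTI.
(* The [n]-th digit of the code at [e] tells whether [w e] is in [C n]. *)
exists [set w | 2^-1 < iter n (@ternary_shift R) (w e)].
  rewrite -[X in measurable X]setTI.
  exact: (measurable_power_proj e measurableT (measurable_ternary_bit n)).
by apply/seteqP; split=> w; rewrite /= /power_map /= ternary_bit in_setE.
Qed.

Theorem theorem2p2 (R : realType) (d : measure_display) (T : measurableType d)
    (P : probability T R) (E : finType) (A : set (power E T)) :
  measurable A ->
  exists B : set (power E (lebesgue_itv R)),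
    [/\ measurable B,
        power_prob (@lebesgue_itv_prob R) E B = power_prob P E A &
        forall e : E, influence (@lebesgue_itv_prob R) B e = influence P A e].
Proof.
move=> /measurable_seq_cylinder[C mC /(ternary_factorization R)[A' mA' ->]].
pose phi (x : T) : measurableTypeR R := ternary R (fun n => x \in C n).
rewrite -/phi.
have mphi : measurable_fun [set: T] phi by exact: measurable_ternary.
pose Phi : {mfun T >-> measurableTypeR R} :=
  HB.pack phi (isMeasurableFun.Build _ _ _ _ phi mphi).
pose mu : probability _ R := distribution P Phi.
have Pmu (X : set (measurableTypeR R)) : measurable X -> P (phi @^-1` X) = mu X.
  by [].
have mq := measurable_quantile_itv mu; have qmu := @quantile_itv_preimage _ mu.
exists (power_map (quantile_itv mu) (E:=E) @^-1` A'); split.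
- by rewrite -[X in measurable X]setTI; exact: measurable_power_map.
(* Both events are preimages of [A'], so each side reduces to its value for [A'] under [mu]; the
   same holds for influences. *)
- by rewrite (power_prob_preimage mq qmu)// (power_prob_preimage mphi Pmu).
- move=> e.
  by rewrite (influence_preimage mq qmu)// (influence_preimage mphi Pmu).
Qed.
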